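(* Let $q\in\Bbbk^\ast$ with $q^2\neq 1$, and let $\sigma$ be the automorphism of $\Bbbk_q[x,y]$ given by $\sigma(x)=\alpha x$, $\sigma(y)=\beta y$, with $\alpha,\beta\in\Bbbk^\ast$. Identify an automorphism $\rho$ with $\rho(x)=\mu_1x$, $\rho(y)=\mu_2y$ with the pair $(\mu_1,\mu_2)\in\Bbbk^\ast\times\Bbbk^\ast$. Then the following hold. (1) (Inner family.) For $i,j\ge 0$, let $\delta_{y^jx^i}$ be the inner $\sigma$-derivation $b\mapsto y^jx^i\sigma(b)-b\,y^jx^i$. If $\delta_{y^jx^i}\neq 0$, then $$\mathrm{Aut}_{\delta_{y^jx^i}}(\Bbbk_q[x,y])=\{(\mu_1,\mu_2)\in\Bbbk^\ast\times\Bbbk^\ast:\ \mu_1^i\mu_2^j=1\}.$$ (2) (The $\mathcal P_x$-family.) Suppose $\beta=q$ and let $\mathcal P_x$ be the $\sigma$-derivation with $\mathcal P_x(x)=a(y)$, $\mathcal P_x(y)=0$, where $a(y)=\sum_{r\ge0}a_ry^r\in\Bbbk[y]$. Then $$\mathrm{Aut}_{\mathcal P_x}(\Bbbk_q[x,y])=\{(\mu_1,\mu_2)\in\Bbbk^\ast\times\Bbbk^\ast:\ \mu_1=\mu_2^r\ \text{for all } r \text{ such that } a_r\neq 0\}.$$ (3) (The $\mathcal P_y$-family.) Suppose $\alpha=q^{-1}$ and let $\mathcal P_y$ be the $\sigma$-derivation with $\mathcal P_y(x)=0$, $\mathcal P_y(y)=b(x)$, where $b(x)=\sum_{s\ge0}b_sx^s\in\Bbbk[x]$.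 Then $$\mathrm{Aut}_{\mathcal P_y}(\Bbbk_q[x,y])=\{(\mu_1,\mu_2)\in\Bbbk^\ast\times\Bbbk^\ast:\ \mu_2=\mu_1^s\ \text{for all } s \text{ such that } b_s\neq 0\}.$$ (4) (The $\lambda D_x$ and $\lambda D_y$ families.) Suppose $\alpha=q^n$ and $\beta=q^{-m}$ for some integers $n,m\ge0$, take $n$ and $m$ to be the smallest nonnegative integers with this property, and let $D_x,D_y$ be the $\sigma$-derivations with $D_x(x)=(y^nx^m)x$, $D_x(y)=0$ and $D_y(x)=0$, $D_y(y)=(y^nx^m)y$. Let $\lambda(x^t,y^t)=\sum c_{ab}(x^t)^a(y^t)^b\in\Bbbk[x^t,y^t]$. Then $$\mathrm{Aut}_{\lambda D_x}(\Bbbk_q[x,y])=\mathrm{Aut}_{\lambda D_y}(\Bbbk_q[x,y])=\{(\mu_1,\mu_2)\in\Bbbk^\ast\times\Bbbk^\ast:\ \mu_1^{m+at}\mu_2^{n+bt}=1\ \text{for all } (a,b)\text{ such that } c_{ab}\neq0\}.$$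
   Context: $\Bbbk$ is an algebraically closed field of characteristic zero. The quantum plane $\Bbbk_q[x,y]$ is the $\Bbbk$-algebra generated by $x,y$ with the relation $xy=qyx$; the monomials $y^jx^i$ ($i,j\ge0$) form a $\Bbbk$-basis. For $q^2\neq1$ every automorphism of $\Bbbk_q[x,y]$ has the form $\rho(x)=\mu_1x$, $\rho(y)=\mu_2y$ with $\mu_1,\mu_2\in\Bbbk^\ast$. Notation $t$: if $q$ is a root of unity, $t$ is its order in $\Bbbk^\ast$; otherwise $t=0$. The center of $\Bbbk_q[x,y]$ is $\Bbbk[x^t,y^t]$, with the convention $\Bbbk[x^0,y^0]=\Bbbk$ (so for $t=0$, $\lambda$ is a constant $c_{00}$). For an automorphism $\sigma$ of an algebra $A$, a $\sigma$-derivation is a $\Bbbk$-linear map $\delta:A\to A$ with $\delta(ab)=\delta(a)\sigma(b)+a\delta(b)$ for all $a,b\in A$. Its isotropy group is $\mathrm{Aut}_\delta(A)=\{\rho\in\mathrm{Aut}(A):\rho\sigma=\sigma\rho,\ \rho\delta=\delta\rho\}$. For central $\lambda$, $\lambda\delta$ is the $\sigma$-derivation $b\mapsto\lambda\,\delta(b)$. The maps prescribed on generators in (2)–(4) extend uniquely to $\sigma$-derivations under the stated conditions on $\alpha,\beta$. *)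

(* Defs.v *)
From HB Require Import structures.
From mathcomp Require Import all_boot all_order all_algebra.
Set Implicit Arguments. Unset Strict Implicit. Unset Printing Implicit Defensive.
Import GRing.Theory.
Local Open Scope ring_scope.

Section QMul.
Variables (K : fieldType) (q : K).
Implicit Types p r s : {poly {poly K}}.

(* f(y) x^i is encoded by f *: 'X^i with f : {poly K} a polynomial in y, and
   x^i r = (qtwist i r) x^i, where qtwist i substitutes q^i y for y. *)
Definition qtwist (i : nat) : {poly {poly K}} -> {poly {poly K}} :=
  map_poly (comp_poly (q ^+ i *: 'X)).

Definition qmul p r : {poly {poly K}} :=
  \sum_(i < size p) p`_i *: ('X^i * qtwist i r).

HB.instance Definition _ i := GRing.RMorphism.copy (qtwist i)
  (map_poly (comp_poly (q ^+ i *: 'X))).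

Lemma qtwist_sum n i (F : 'I_n -> {poly {poly K}}) :
  qtwist i (\sum_(k < n) F k) = \sum_(k < n) qtwist i (F k).
Proof. exact: rmorph_sum. Qed.

Lemma qtwistZ i (c : {poly K}) r :
  qtwist i (c *: r) = (c \Po (q ^+ i *: 'X)) *: qtwist i r.
Proof. exact: map_polyZ. Qed.

Lemma qtwistXn i n : qtwist i 'X^n = 'X^n.
Proof. exact: map_polyXn. Qed.

Lemma qtwistD i j r : qtwist i (qtwist j r) = qtwist (i + j) r.
Proof.
apply/polyP=> k; rewrite !coef_map /= -comp_polyA comp_polyZ comp_polyX.
by rewrite scalerA -exprD addnC.
Qed.

Lemma qtwist0 r : qtwist 0 r = r.
Proof. by apply/polyP=> k; rewrite coef_map /= expr0 scale1r comp_polyXr. Qed.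

Lemma qmulE n p r : (size p <= n)%N ->
  qmul p r = \sum_(i < n) p`_i *: ('X^i * qtwist i r).
Proof.
move=> le_pn; rewrite /qmul (big_ord_widen n (fun i => p`_i *: ('X^i * qtwist i r))) //.
rewrite big_mkcond /=; apply: eq_bigr => i _; case: ltnP => // le_pi.
by rewrite nth_default // scale0r.
Qed.

Lemma qmulDl : left_distributive qmul +%R.
Proof.
move=> p r s; pose n := maxn (size p) (size r).
rewrite !(@qmulE n) ?leq_maxl ?leq_maxr ?size_polyD //.
by rewrite -big_split; apply: eq_bigr => i _; rewrite coefD scalerDl.
Qed.

Lemma qmulDr : right_distributive qmul +%R.
Proof.
move=> p r s; rewrite -big_split; apply: eq_bigr => i _.
by rewrite rmorphD mulrDr scalerDr.
Qed.

Lemma qmul0l r : qmul 0 r = 0.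
Proof. by rewrite /qmul size_poly0 big_ord0. Qed.

Lemma qmul_suml I (l : seq I) (P : pred I) F r :
  qmul (\sum_(i <- l | P i) F i) r = \sum_(i <- l | P i) qmul (F i) r.
Proof. exact: (big_morph (qmul^~ r) (fun a b => qmulDl a b r) (qmul0l r)). Qed.

Lemma qmulZl c p r : qmul (c *: p) r = c *: qmul p r.
Proof.
rewrite (@qmulE (size p)) ?size_scale_leq // /qmul scaler_sumr.
by apply: eq_bigr => i _; rewrite coefZ scalerA.
Qed.

Lemma qmulXn n r : qmul 'X^n r = 'X^n * qtwist n r.
Proof.
rewrite /qmul size_polyXn big_ord_recr /= big1 ?add0r ?coefXn ?eqxx ?scale1r //.
by move=> i _; rewrite coefXn ltn_eqF ?scale0r.
Qed.

Lemma qmulMXn n r s : qmul ('X^n * r) s = 'X^n * qmul r (qtwist n s).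
Proof.
rewrite -{1}[r]coefK poly_def mulr_sumr qmul_suml [in RHS]/qmul mulr_sumr.
apply: eq_bigr => i _.
by rewrite -!scalerAr qmulZl -exprD qmulXn exprD qtwistD -mulrA addnC.
Qed.

Lemma qtwistM n r s : qtwist n (qmul r s) = qmul (qtwist n r) (qtwist n s).
Proof.
rewrite [in RHS](@qmulE (size r)) ?size_poly // /qmul rmorph_sum.
apply: eq_bigr => i _.
by rewrite coef_map /= qtwistZ rmorphM /= qtwistXn !qtwistD addnC.
Qed.

Lemma qmulA : associative qmul.
Proof.
move=> p r s; rewrite {2}/qmul qmul_suml; apply: eq_bigr => i _.
by rewrite qmulZl qmulMXn qtwistM.
Qed.

Lemma qmul1l : left_id 1 qmul.
Proof. by move=> r; have := qmulXn 0 r; rewrite expr0 mul1r qtwist0. Qed.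

Lemma qmul1r : right_id 1 qmul.
Proof.
move=> p; rewrite -[RHS]coefK poly_def; apply: eq_bigr => i _.
by rewrite rmorph1 mulr1.
Qed.

End QMul.

(* The quantum plane K_q[x,y]: the coefficient of y^j x^i in f is f`_i`_j. *)
Definition qplane (K : fieldType) (q : K) : Type := {poly {poly K}}.

Section QPlane.
Variables (K : fieldType) (q : K).

HB.instance Definition _ := GRing.Zmodule.copy (qplane q) {poly {poly K}}.
HB.instance Definition _ := GRing.Zmodule_isNzRing.Build (qplane q)
  (@qmulA K q) (@qmul1l K q) (@qmul1r K q) (@qmulDl K q) (@qmulDr K q)
  (oner_neq0 {poly {poly K}}).

Definition qscale (c : K) (f : qplane q) : qplane q :=
  c%:P *: (f : {poly {poly K}}).

Fact qscaleA a b f : qscale a (qscale b f) = qscale (a * b) f.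
Proof. by rewrite /qscale scalerA polyCM. Qed.
Fact qscale1 : left_id 1 qscale.
Proof. by move=> f; rewrite /qscale scale1r. Qed.
Fact qscaleDr : right_distributive qscale +%R.
Proof. by move=> c f g; rewrite /qscale scalerDr. Qed.
Fact qscaleDl f : {morph qscale^~ f : a b / a + b}.
Proof. by move=> a b; rewrite /qscale polyCD scalerDl. Qed.
HB.instance Definition _ := GRing.Zmodule_isLmodule.Build K (qplane q)
  qscaleA qscale1 qscaleDr qscaleDl.

Fact qscaleAl (c : K) (f g : qplane q) : c *: (f * g) = (c *: f) * g.
Proof. exact/esym/qmulZl. Qed.
HB.instance Definition _ := GRing.Lmodule_isLalgebra.Build K (qplane q) qscaleAl.

Fact qscaleAr (c : K) (f g : qplane q) : c *: (f * g) = f * (c *: g).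
Proof.
rewrite /GRing.scale /= /qscale /GRing.mul /= /qmul scaler_sumr.
apply: eq_bigr => i _.
by rewrite qtwistZ comp_polyC -scalerAr !scalerA mulrC.
Qed.
HB.instance Definition _ := GRing.Lalgebra_isAlgebra.Build K (qplane q) qscaleAr.

Definition qx : qplane q := ('X : {poly {poly K}}).
Definition qy : qplane q := (('X : {poly K})%:P : {poly {poly K}}).

Lemma qplane_rel : qx * qy = q *: (qy * qx).
Proof.
rewrite /GRing.scale /= /qscale /GRing.mul /= /qx /qy.
rewrite -{1}['X]expr1 qmulXn -[('X)%:P]alg_polyC qmulZl qmul1l qtwistZ rmorph1.
by rewrite comp_polyX !expr1 -scalerAr mulr1 scalerA mul_polyC.
Qed.

Lemma qmonE i j : qy ^+ j * qx ^+ i = ('X^j *: 'X^i : {poly {poly K}}).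
Proof.
have ->: qx ^+ i = ('X^i : {poly {poly K}}).
  elim: i => // i IHi; rewrite exprS IHi /GRing.mul /= /qx -{1}['X]expr1.
  by rewrite qmulXn qtwistXn -exprD.
have ->: qy ^+ j = (('X^j)%:P : {poly {poly K}}).
  elim: j => [|j IHj]; first by rewrite !expr0.
  rewrite exprS IHj /GRing.mul /= /qy -['X%:P]alg_polyC qmulZl qmul1l.
  by rewrite -mul_polyC -polyCM -exprS.
by rewrite -alg_polyC /GRing.mul /= qmulZl qmul1l.
Qed.

Lemma qplane_basis (f : qplane q) :
  f = \sum_(i < size (f : {poly {poly K}}))
        \sum_(j < size f`_i) f`_i`_j *: (qy ^+ j * qx ^+ i).
Proof.
rewrite -[LHS]coefK poly_def; apply: eq_bigr => i _.
rewrite -[in LHS](coefK f`_i) poly_def scaler_suml; apply: eq_bigr => j _.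
by rewrite qmonE -[f`_i`_j *: 'X^j]mul_polyC -scalerA.
Qed.

Section Universal.
Variables (B : algType K) (X Y : B).
Hypothesis relXY : X * Y = q *: (Y * X).

Let h : {rmorphism {poly K} -> B} := horner_alg Y.
Let hX : h 'X = Y. Proof. exact: horner_algX. Qed.
Let hZ c p : h (c *: p) = c *: h p.
Proof. by rewrite -mul_polyC rmorphM /= [h _]horner_algC mulr_algl. Qed.
Let qeval (f : qplane q) : B :=
  \sum_(i < size (f : {poly {poly K}})) h f`_i * X ^+ i.

Let qevalE n (f : qplane q) : (size (f : {poly {poly K}}) <= n)%N ->
  qeval f = \sum_(i < n) h f`_i * X ^+ i.
Proof.
move=> le_fn; rewrite /qeval.
rewrite (big_ord_widen n (fun i => h f`_i * X ^+ i)) //.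
rewrite big_mkcond /=; apply: eq_bigr => i _; case: ltnP => // le_fi.
by rewrite nth_default // rmorph0 mul0r.
Qed.

Let qeval_linear : linear qeval.
Proof.
move=> c f g; pose n := maxn (size (f : {poly {poly K}})) (size (g : {poly {poly K}})).
have le_fn : (size (f : {poly {poly K}}) <= n)%N by rewrite leq_maxl.
have le_gn : (size (g : {poly {poly K}}) <= n)%N by rewrite leq_maxr.
have le_cn : (size (c *: f : {poly {poly K}}) <= n)%N.
  exact: leq_trans (size_scale_leq _ _) le_fn.
rewrite (qevalE le_fn) (qevalE le_gn) (@qevalE n); last first.
  by rewrite (leq_trans (size_polyD _ _)) // geq_max le_cn.
rewrite scaler_sumr -big_split; apply: eq_bigr => i _ /=.
rewrite coefD [X in h (X + _)]coefZ rmorphD mulrDl mul_polyC.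
by rewrite hZ scalerAl.
Qed.

Let comXY i (c : {poly K}) : X ^+ i * h c = h (c \Po (q ^+ i *: 'X)) * X ^+ i.
Proof.
have XY1 : X ^+ i * Y = q ^+ i *: (Y * X ^+ i).
  elim: i => [|i IHi]; first by rewrite mul1r mulr1 scale1r.
  rewrite [X ^+ _]exprSr -mulrA relXY -scalerAr [X ^+ i * (Y * X)]mulrA IHi.
  by rewrite -scalerAl scalerA -exprS mulrA.
have hC d : h d%:P = d *: 1 by exact: horner_algC.
elim/poly_ind: c => [|c d IHc]; first by rewrite comp_poly0 !rmorph0 mul0r mulr0.
rewrite comp_polyD comp_polyM comp_polyX comp_polyC !(rmorphD h) !(rmorphM h) hZ.
rewrite !hX !hC mulrDr mulrDl [X ^+ i * _]mulrA IHc -(mulrA _ _ Y) XY1.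
by rewrite -!(scalerAr, scalerAl) mul1r mulr1 mulrA.
Qed.

Let qeval_mon (c : {poly K}) i :
  qeval ((c *: 'X^i : {poly {poly K}}) : qplane q) = h c * X ^+ i.
Proof.
rewrite (@qevalE i.+1); last first.
  by rewrite (leq_trans (size_scale_leq _ _)) ?size_polyXn.
rewrite big_ord_recr /= big1 ?add0r ?coefZ ?coefXn ?eqxx ?mulr1 // => j _.
by rewrite coefZ coefXn ltn_eqF // mulr0 rmorph0 mul0r.
Qed.

Let qeval_sum n (F : 'I_n -> qplane q) :
  qeval (\sum_(i < n) F i) = \sum_(i < n) qeval (F i).
Proof.
pose mL := GRing.isLinear.Build K (qplane q) B *:%R qeval qeval_linear.
pose L : {linear qplane q -> B} := HB.pack qeval mL.
exact: (linear_sum L).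
Qed.

Let qeval_monoid : monoid_morphism qeval.
Proof.
split.
  have := qeval_mon 1 0; rewrite scale1r rmorph1 mul1r !expr0; apply.
move=> f g; rewrite {1}/GRing.mul /= /qmul qeval_sum {2}/qeval mulr_suml.
apply: eq_bigr => i _.
rewrite -[g in LHS]coefK poly_def qtwist_sum mulr_sumr scaler_sumr.
rewrite qeval_sum [qeval g]/qeval mulr_sumr; apply: eq_bigr => k _.
rewrite -mulrA [X ^+ i * _]mulrA comXY qtwistZ qtwistXn -scalerAr.
rewrite scalerA -exprD qeval_mon exprD (rmorphM h).
by rewrite !mulrA.
Qed.

Lemma qplane_universal :
  exists2 rho : {lrmorphism qplane q -> B}, rho qx = X /\ rho qy = Y
    & forall rho' : {lrmorphism qplane q -> B},
        rho' qx = X -> rho' qy = Y -> rho' =1 rho.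
Proof.
pose mL := GRing.isLinear.Build K (qplane q) B *:%R qeval qeval_linear.
pose mM := GRing.isMonoidMorphism.Build (qplane q) B qeval qeval_monoid.
pose L : {lrmorphism qplane q -> B} := HB.pack qeval mL mM.
have Lx : L qx = X.
  by have := qeval_mon 1 1; rewrite scale1r rmorph1 mul1r.
have Ly : L qy = Y.
  by have := qeval_mon 'X 0; rewrite alg_polyC hX mulr1.
exists L => // rho' xX yY f.
have E (r : {lrmorphism qplane q -> B}) : r qx = X -> r qy = Y ->
    r f = \sum_(i < size (f : {poly {poly K}}))
            \sum_(j < size f`_i) f`_i`_j *: (Y ^+ j * X ^+ i).
  move=> rx ry; rewrite [in LHS](qplane_basis f) linear_sum.
  apply: eq_bigr => i _; rewrite linear_sum; apply: eq_bigr => j _.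
  by rewrite linearZ rmorphM !rmorphXn /= rx ry.
by rewrite (E rho') // (E L).
Qed.

End Universal.
End QPlane.

Section Isotropy.
Variables (K : fieldType) (A : algType K).
Implicit Types (sigma rho : {lrmorphism A -> A}) (delta : A -> A).

Definition is_sderivation sigma delta : Prop :=
  linear delta /\
  (forall a b, delta (a * b) = delta a * sigma b + a * delta b).

Definition inner_sder sigma (u : A) : A -> A := fun b => u * sigma b - b * u.

(* rho belongs to Aut_delta(A). *)
Definition isotropy sigma delta rho : Prop :=
  [/\ bijective rho, (forall b, rho (sigma b) = sigma (rho b))
    & (forall b, rho (delta b) = delta (rho b))].

End Isotropy.

Section IsotropyQPlane.
Variables (K : fieldType) (q : K).
Implicit Types (sigma rho : {lrmorphism qplane q -> qplane q}).

Definition diag_on_gens rho (mu1 mu2 : K) : Prop :=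
  [/\ mu1 != 0, mu2 != 0, rho (qx q) = mu1 *: qx q & rho (qy q) = mu2 *: qy q].

(* Aut_delta(K_q[x,y]) = {(mu1, mu2) in K^* x K^* | S mu1 mu2}, where the pair
   (mu1, mu2) stands for the automorphism x |-> mu1 x, y |-> mu2 y.  The first
   half quantifies over arbitrary algebra automorphisms, so it also asserts
   that every element of the isotropy group acts diagonally on x and y. *)
Definition isotropy_group_is sigma (delta : qplane q -> qplane q)
    (S : K -> K -> Prop) : Prop :=
  (forall rho, isotropy sigma delta rho ->
     exists mu1 mu2, diag_on_gens rho mu1 mu2 /\ S mu1 mu2) /\
  (forall mu1 mu2, mu1 != 0 -> mu2 != 0 -> S mu1 mu2 ->
     exists rho, diag_on_gens rho mu1 mu2 /\ isotropy sigma delta rho).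

Definition poly_in_x (b : {poly K}) : qplane q :=
  \sum_(s < size b) b`_s *: qx q ^+ s.

Definition poly_in_y (a : {poly K}) : qplane q :=
  \sum_(r < size a) a`_r *: qy q ^+ r.

(* c`_a`_b is the coefficient of (x^t)^a (y^t)^b. *)
Definition poly_in_xt_yt (t : nat) (c : {poly {poly K}}) : qplane q :=
  \sum_(a < size c) \sum_(b < size c`_a)
    c`_a`_b *: ((qx q ^+ t) ^+ a * (qy q ^+ t) ^+ b).

(* t is the order of q if q is a root of unity, and 0 otherwise. *)
Definition order_or_zero (t : nat) : Prop :=
  t.-primitive_root q \/
  (t = 0%N /\ forall n, (0 < n)%N -> q ^+ n != 1).

End IsotropyQPlane.

Definition least_nat (P : nat -> Prop) (n : nat) : Prop :=
  P n /\ (forall k, P k -> (n <= k)%N).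

(* Main.v *)
Require Import Defs.
From HB Require Import structures.
From mathcomp Require Import all_boot all_order all_algebra.
Set Implicit Arguments. Unset Strict Implicit. Unset Printing Implicit Defensive.
Import GRing.Theory.
Local Open Scope ring_scope.

(** Two facts carry the proof.

    Automorphisms are diagonal when [q ^+ 2 != 1].  An algebra morphism from
    the quantum plane to the commutative domain [{poly K}] kills [x] or [y],
    because [x * y = q *: (y * x)] and [q != 1].  If moreover its image
    contains ['X], its kernel is exactly the ideal generated by that generator,
    since the other generator is then sent to a nonconstant polynomial.
    Applied to the composites of an automorphism [rho] with the two projections
    modulo [x] and modulo [y], this shows that [rho] permutes the ideals
    generated by [x] and by [y] ([auto_permutes_ideals]).  Hence [rho] sends a
    generator to a left multiple of a generator, and the same holds for its
    inverse, so that the cofactor is a unit.  Units are scalars, because the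
    size in [x] of a product is governed by the sizes of the factors
    ([size_qmul]).  Exchanging the two ideals would turn the relation into
    [q ^+ 2 = 1] ([qplane_auto_diag]).

    A diagonal automorphism commutes with the diagonal [sigma], so its
    commutation with a [sigma]-derivation [delta] can be tested on [x] and [y]
    ([sderivation_commute_gens]): it says that [delta x] and [delta y] are
    eigenvectors of [rho], with eigenvalues [mu1] and [mu2].  The monomials form
    a basis of eigenvectors, [y ^+ j * x ^+ i] having eigenvalue
    [mu1 ^+ i * mu2 ^+ j], so the condition only concerns the monomials that
    occur in [delta x] and [delta y] ([diag_eigenvector]).  The last three
    families are read off in this way.  For the inner family,
    [rho] maps the inner derivation of a monomial to its multiple by the
    eigenvalue of that monomial, which must then be [1]. *)

Section QuantumPlane.
Variables (K : fieldType) (q : K).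
Hypothesis q_neq0 : q != 0.

Local Notation A := (qplane q).
Local Notation x := (qx q).
Local Notation y := (qy q).

(** * The quantum plane as a domain *)

Lemma qplane_ind (P : A -> Prop) :
    P 0 -> (forall f g, P f -> P g -> P (f + g)) ->
    (forall c f, P f -> P (c *: f)) ->
    (forall i j, P (y ^+ j * x ^+ i)) ->
  forall f, P f.
Proof.
move=> P0 PD PZ Pm f; rewrite [f]qplane_basis.
by do 2!elim/big_ind: _ => // *; apply: PZ.
Qed.

Lemma qplane_lrmorph_ext (B : algType K) (r s : {lrmorphism A -> B}) :
  r x = s x -> r y = s y -> r =1 s.
Proof.
move=> rsx rsy; elim/qplane_ind => [|f g Ef Eg|c f Ef|i j].
- by rewrite !rmorph0.
- by rewrite !rmorphD /= Ef Eg.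
- by rewrite !linearZ /= Ef.
by rewrite !rmorphM !rmorphXn /= rsx rsy.
Qed.

Lemma expr_qx_qy i j : x ^+ i * y ^+ j = q ^+ (i * j) *: (y ^+ j * x ^+ i).
Proof.
have xyj : x * y ^+ j = q ^+ j *: (y ^+ j * x).
  elim: j => [|j IHj]; first by rewrite mulr1 mul1r scale1r.
  rewrite exprS mulrA qplane_rel -scalerAl -[y * x * _]mulrA IHj -scalerAr.
  by rewrite scalerA mulrA -!exprS.
elim: i => [|i IHi]; first by rewrite mul1r mulr1 scale1r.
rewrite exprS -mulrA IHi -scalerAr [x * (_ * _)]mulrA xyj -scalerAl scalerA.
by rewrite -exprD -mulrA mulSn addnC.
Qed.

Lemma size_qtwist i (r : {poly {poly K}}) : size (qtwist q i r) = size r.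
Proof.
have [->|r0] := eqVneq r 0; first by rewrite rmorph0.
apply: size_map_poly_id0; rewrite comp_poly2_eq0 ?lead_coef_eq0 //.
by rewrite size_scale ?expf_neq0 // size_polyX.
Qed.

(** The quantum plane is a skew polynomial ring in [x] over the domain
    [{poly K}]: twisting a leading coefficient does not kill it. *)
Lemma size_qmul (p r : {poly {poly K}}) :
  p != 0 -> r != 0 -> size (qmul q p r) = (size p + size r).-1.
Proof.
move=> p0 r0; rewrite /qmul (polySpred p0) big_ord_recr /= addrC.
have szt i : size ('X^i * qtwist q i r) = (i + size r)%N.
  by rewrite mulrC size_mulXn ?size_qtwist // -size_poly_eq0 size_qtwist size_poly_eq0.
have szl : size (p`_(size p).-1 *: ('X^((size p).-1) * qtwist q (size p).-1 r))
  = ((size p).-1 + size r)%N.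
  by rewrite -mul_polyC size_Cmul ?szt // -lead_coefE lead_coef_eq0.
rewrite size_polyDl szl // (leq_ltn_trans (size_sum _ _ _)) //.
rewrite (@leq_ltn_trans ((size p).-1 + size r).-1) //; last first.
  by rewrite ltn_predL addn_gt0 size_poly_gt0 r0 orbT.
apply/bigmax_leqP => i _; apply: leq_trans (size_scale_leq _ _) _; rewrite szt.
rewrite -ltnS prednK; first by rewrite ltn_add2r.
by rewrite addn_gt0 size_poly_gt0 r0 orbT.
Qed.

Lemma qplane_mulf_eq0 (f g : A) : f * g = 0 -> f = 0 \/ g = 0.
Proof.
have [->|f0] := eqVneq f 0; first by left.
have [->|g0] := eqVneq g 0; first by right.
move=> fg0; suff: (0 < size (qmul q f g))%N by rewrite [qmul q f g]fg0 size_poly0.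
rewrite size_qmul // (polySpred f0) addSn addn_gt0 orbC lt0n size_poly_eq0.
by rewrite g0.
Qed.

(** By sizes, both factors lie in [{poly K}], whose units are the nonzero
    constants. *)
Lemma qplane_unit_scalar (f g : A) :
  f * g = 1 -> exists2 c : K, c != 0 & g = c *: 1.
Proof.
move=> fg1.
have f0 : f != 0 by apply: contra_eq_neq fg1 => ->; rewrite mul0r eq_sym oner_neq0.
have g0 : g != 0 by apply: contra_eq_neq fg1 => ->; rewrite mulr0 eq_sym oner_neq0.
have := size_qmul f0 g0; rewrite [qmul q f g]fg1 (size_poly1 {poly K}).
rewrite (polySpred f0) (polySpred g0) addSn addnS /= => -[].
move=> /esym/eqP; rewrite addn_eq0 => /andP[/eqP szf /eqP szg].
have /size1_polyC Ef : (size (f : {poly {poly K}}) <= 1)%N by rewrite (polySpred f0) szf.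
have /size1_polyC Eg : (size (g : {poly {poly K}}) <= 1)%N by rewrite (polySpred g0) szg.
set a := f`_0 in Ef; set b := g`_0 in Eg.
have /polyC_inj ab1 : (a * b)%:P = 1%:P :> {poly {poly K}}.
  transitivity (qmul q a%:P b%:P); last by rewrite -Ef -Eg.
  by rewrite -(alg_polyC a) qmulZl qmul1l polyCM mul_polyC.
have bU : b \is a GRing.unit by apply/unitrPr; exists a; rewrite mulrC.
have := bU; rewrite poly_unitE unitfE => /andP[/eqP szb b0].
exists b`_0 => //; rewrite Eg (size1_polyC (p := b)) ?szb // coefC /=.
by rewrite -alg_polyC.
Qed.

(** * The ideals generated by x and by y *)

(** The generators are indexed by a boolean because [x] and [y] play symmetric
    roles below: [gen (~~ b)] is the generator other than [gen b]. *)
Definition gen (b : bool) : A := if b then x else y.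

Lemma gen_neq0 b : gen b != 0.
Proof. by case: b; rewrite ?polyC_eq0 polyX_eq0. Qed.

(** Each monomial is either a power of the other generator or, up to a power of
    the invertible scalar [q], a left multiple of [gen b]. *)
Lemma gen_decomposition b (f : A) :
  exists (w : A) (p : {poly K}), f = w * gen b + horner_alg (gen (~~ b)) p.
Proof.
elim/qplane_ind: f => [|f g [w [p ->]] [v [r ->]]|c f [w [p ->]]|i j].
- by exists 0, 0; rewrite rmorph0 mul0r addr0.
- by exists (w + v), (p + r); rewrite mulrDl rmorphD addrACA.
- by exists (c *: w), (c *: p); rewrite linearZ /= mulr_algl scalerDr scalerAl.
case: b => /=.
  case: i => [|i].
    by exists 0, 'X^j; rewrite rmorphXn /= horner_algX mul0r add0r mulr1.
  by exists (y ^+ j * x ^+ i), 0; rewrite rmorph0 addr0 exprSr mulrA.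
case: j => [|j].
  by exists 0, 'X^i; rewrite rmorphXn /= horner_algX mul0r add0r mul1r.
(* Moving [y ^+ j.+1] to the right of [x ^+ i] costs this scalar. *)
exists (q ^- (i * j.+1) *: (x ^+ i * y ^+ j)), 0.
rewrite rmorph0 addr0 -scalerAl -mulrA -exprSr expr_qx_qy scalerA.
by rewrite mulVf ?scale1r // expf_neq0.
Qed.

(** The projection modulo [gen b], in which ['X] is the class of the other
    generator. *)
Lemma gen_character b : exists chi : {lrmorphism A -> {poly K}},
  chi (gen b) = 0 /\ chi (gen (~~ b)) = 'X.
Proof.
have rel : (if b then 0 else 'X) * (if b then 'X else 0)
    = q *: ((if b then 'X else 0) * (if b then 0 else 'X)) :> {poly K}.
  by case: b; rewrite mul0r mulr0 scaler0.
by have [chi [chix chiy] _] := qplane_universal rel; exists chi; case: b rel chix chiy.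
Qed.

Lemma gen_character_ker b (chi : {lrmorphism A -> {poly K}}) :
    chi (gen b) = 0 -> chi (gen (~~ b)) = 'X ->
  forall f, chi f = 0 <-> exists w, f = w * gen b.
Proof.
move=> chi0 chiX f; split=> [|[w ->]]; last by rewrite rmorphM /= chi0 mulr0.
have [w [p ->]] := gen_decomposition b f.
have chip : chi (horner_alg (gen (~~ b)) p) = p.
  elim/poly_ind: p => [|p c IHp]; first by rewrite !rmorph0.
  rewrite !(rmorphD, rmorphM) /= horner_algX horner_algC IHp chiX.
  by rewrite linearZ rmorph1 /= alg_polyC.
rewrite rmorphD rmorphM /= chi0 mulr0 add0r chip => ->.
by exists w; rewrite rmorph0 addr0.
Qed.

(** * Automorphisms are diagonal *)

Section Automorphism.
Hypothesis q2_neq1 : q ^+ 2 != 1.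
Variable rho : {lrmorphism A -> A}.
Hypothesis rho_bij : bijective rho.

Let q_neq1 : q != 1.
Proof. by apply: contra_neq q2_neq1 => ->; rewrite expr1n. Qed.

Lemma qplane_to_poly_factor (psi chi : {lrmorphism A -> {poly K}}) b :
    psi (gen b) = 0 -> chi (gen b) = 0 -> chi (gen (~~ b)) = 'X ->
  forall f, psi f = chi f \Po psi (gen (~~ b)).
Proof.
move=> psi0 chi0 chiX f.
apply: (@qplane_lrmorph_ext _ psi (comp_poly (psi (gen (~~ b))) \o chi)) => /=.
  by case: b psi0 chi0 chiX => /= psi0 chi0 chiX;
     rewrite ?chi0 ?chiX ?comp_poly0 ?comp_polyX.
by case: b psi0 chi0 chiX => /= psi0 chi0 chiX;
   rewrite ?chi0 ?chiX ?comp_poly0 ?comp_polyX.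
Qed.

(** In the commutative domain [{poly K}] the defining relation becomes
    [(1 - q) *: (psi x * psi y) = 0]. *)
Lemma qplane_to_poly_gen (psi : {lrmorphism A -> {poly K}}) :
  exists b, psi (gen b) = 0.
Proof.
have : psi (x * y) = psi (q *: (y * x)) by rewrite qplane_rel.
rewrite linearZ !rmorphM /= [psi y * _]mulrC => /eqP.
rewrite -subr_eq0 -[X in X - _]scale1r -scalerBl scaler_eq0 subr_eq0.
rewrite [1 == q]eq_sym (negPf q_neq1) mulf_eq0 /= => /orP[]/eqP; first by exists true.
by exists false.
Qed.

(** The projection [chi] modulo [gen b], composed with [rho], kills some
    [gen b'], so it is the projection modulo [gen b'] followed by the
    substitution of a polynomial for ['X].  Surjectivity of [rho] makes this
    polynomial nonconstant, and such a substitution is injective. *)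
Lemma auto_permutes_ideals b : exists b', forall f,
  (exists w, rho f = w * gen b) <-> (exists w, f = w * gen b').
Proof.
have [rho' rhoK rho'K] := rho_bij.
have [chi [chi0 chiX]] := gen_character b.
have [b' psi0] := qplane_to_poly_gen (chi \o rho).
have [chi' [chi'0 chi'X]] := gen_character b'.
exists b' => f.
apply: iff_trans (iff_sym (gen_character_ker chi0 chiX _)) _.
apply: iff_trans _ (gen_character_ker chi'0 chi'X _).
have E g : chi (rho g) = _ := qplane_to_poly_factor psi0 chi'0 chi'X g.
have nonconst : (1 < size (chi (rho (gen (~~ b')))))%N.
  rewrite ltnNge; apply/negP => /size1_polyC Ec.
  have := E (rho' (gen (~~ b))); rewrite rho'K chiX /= Ec comp_polyCr.
  move=> /(congr1 (fun p : {poly K} => size p)); rewrite size_polyX size_polyC.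
  by case: (_ != 0).
by rewrite E; split=> [/eqP|->]; rewrite ?comp_poly0 //= comp_poly_eq0 // => /eqP.
Qed.

Lemma gen_not_divides b w : gen (~~ b) <> w * gen b.
Proof.
have [chi [chi0 chiX]] := gen_character b => E.
have : chi (gen (~~ b)) = 0 by apply/(gen_character_ker chi0 chiX); exists w.
by rewrite chiX => /eqP; rewrite polyX_eq0.
Qed.

(** [rho] sends [gen b'] to a left multiple of [gen b], and its inverse sends
    [gen b] to a left multiple of [gen b'], so the cofactors are units. *)
Lemma auto_gen_scalar b b' :
    (forall f, (exists w, rho f = w * gen b) <-> (exists w, f = w * gen b')) ->
  exists2 c : K, c != 0 & rho (gen b') = c *: gen b.
Proof.
move=> perm_b; have [rho' rhoK rho'K] := rho_bij.
have [u Eu] : exists u, rho (gen b') = u * gen b.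
  by apply/perm_b; exists 1; rewrite mul1r.
have [w Ew] : exists w, rho' (gen b) = w * gen b'.
  by apply/perm_b; exists 1; rewrite rho'K mul1r.
have wu1 : rho w * u = 1.
  have : (rho w * u - 1) * gen b = 0.
    by rewrite mulrBl mul1r -mulrA -Eu -rmorphM -Ew /= rho'K subrr.
  case/qplane_mulf_eq0 => [/eqP|/eqP gb0]; first by rewrite subr_eq0 => /eqP.
  by move: (gen_neq0 b); rewrite gb0.
have [c c0 Ec] := qplane_unit_scalar wu1; exists c => //.
by rewrite Eu Ec -scalerAl mul1r.
Qed.

(** If both ideals came from the same one, then [x] would be a multiple of [y];
    so [rho] fixes or exchanges them.  An exchange would give [q ^+ 2 = 1] by
    applying [rho] to the defining relation. *)
Theorem qplane_auto_diag : exists mu1 mu2, diag_on_gens rho mu1 mu2.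
Proof.
have [rho' rhoK rho'K] := rho_bij.
have [b1 perm1] := auto_permutes_ideals true.
have [b2 perm2] := auto_permutes_ideals false.
have neq_b : b2 = ~~ b1.
  apply/eqP; rewrite -[b2 == _]negbK; apply/negP => /negPf Eb.
  have {}Eb : b2 = b1 by case: (b1) (b2) Eb => [] [].
  have [w Ew] : exists w, rho (rho' x) = w * gen false.
    by apply/perm2; rewrite Eb; apply/perm1; exists 1; rewrite rho'K mul1r.
  by rewrite rho'K in Ew; apply: (@gen_not_divides false w).
have [c1 c1_neq0 E1] := auto_gen_scalar perm1.
have [c2 c2_neq0 E2] := auto_gen_scalar perm2.
rewrite {b2}neq_b in perm2 E2.
case: b1 E1 E2 {perm1 perm2} => /= E1 E2; first by exists c1, c2.
have : rho (x * y) = rho (q *: (y * x)) by rewrite qplane_rel.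
rewrite linearZ /= !rmorphM /= E1 E2 -!scalerAl -!scalerAr qplane_rel !scalerA.
move=> /eqP; rewrite -subr_eq0 -scalerBl scaler_eq0 => /orP[|/eqP].
  have -> : c2 * c1 - q * c1 * c2 * q = c1 * c2 * (1 - q ^+ 2).
    by rewrite mulrBr mulr1 expr2 [c2 * _]mulrC -!mulrA [q * (c1 * _)]mulrC -!mulrA.
  by rewrite !mulf_eq0 (negPf c1_neq0) (negPf c2_neq0) subr_eq0 eq_sym (negPf q2_neq1).
by case/qplane_mulf_eq0 => /eqP; rewrite ?(negPf (gen_neq0 false)) ?(negPf (gen_neq0 true)).
Qed.

End Automorphism.

(** * Diagonal automorphisms and eigenvectors *)

Lemma diag_monomial (rho : {lrmorphism A -> A}) mu1 mu2 i j :
    diag_on_gens rho mu1 mu2 ->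
  rho (y ^+ j * x ^+ i) = (mu1 ^+ i * mu2 ^+ j) *: (y ^+ j * x ^+ i).
Proof.
move=> [_ _ rx ry]; rewrite rmorphM !rmorphXn /= rx ry !exprZn.
by rewrite -scalerAl -scalerAr scalerA mulrC.
Qed.

Lemma diag_commute (rho sigma : {lrmorphism A -> A}) mu1 mu2 alpha beta :
    rho x = mu1 *: x -> rho y = mu2 *: y ->
    sigma x = alpha *: x -> sigma y = beta *: y ->
  forall f, rho (sigma f) = sigma (rho f).
Proof.
move=> rx ry sx sy; apply: (qplane_lrmorph_ext (r := rho \o sigma) (s := sigma \o rho)) => /=.
  by rewrite sx rx !linearZ /= sx rx !scalerA mulrC.
by rewrite sy ry !linearZ /= sy ry !scalerA mulrC.
Qed.

Lemma diag_lrmorph_exists mu1 mu2 :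
  exists rho : {lrmorphism A -> A}, rho x = mu1 *: x /\ rho y = mu2 *: y.
Proof.
have rel : (mu1 *: x) * (mu2 *: y) = q *: ((mu2 *: y) * (mu1 *: x)).
  rewrite -!scalerAl -!scalerAr qplane_rel !scalerA; congr (_ *: _).
  by rewrite mulrC mulrA mulrAC.
by have [rho rho_gens _] := qplane_universal rel; exists rho.
Qed.

Lemma diag_auto_exists mu1 mu2 : mu1 != 0 -> mu2 != 0 ->
  exists rho : {lrmorphism A -> A}, diag_on_gens rho mu1 mu2 /\ bijective rho.
Proof.
move=> mu1_neq0 mu2_neq0; have [rho [rx ry]] := diag_lrmorph_exists mu1 mu2.
have [rho' [rx' ry']] := diag_lrmorph_exists mu1^-1 mu2^-1.
exists rho; split=> //; exists rho'.
  apply: (qplane_lrmorph_ext (r := rho' \o rho) (s := idfun)) => /=.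
    by rewrite rx linearZ /= rx' scalerA divff ?scale1r.
  by rewrite ry linearZ /= ry' scalerA divff ?scale1r.
apply: (qplane_lrmorph_ext (r := rho \o rho') (s := idfun)) => /=.
  by rewrite rx' linearZ /= rx scalerA mulVf ?scale1r.
by rewrite ry' linearZ /= ry scalerA mulVf ?scale1r.
Qed.

(** Injectivity of the exponents is asked only on the range of summation.  This
    allows sums reduced to a single term, whose exponents may be given by
    constant functions. *)
Lemma monomial_sum_free N (M : nat -> nat) (d : nat -> nat -> K) (e f : nat -> nat) :
    (forall a a', (a < N)%N -> (a' < N)%N -> f a = f a' -> a = a') ->
    (forall a b b', (a < N)%N -> (b < M a)%N -> (b' < M a)%N -> e b = e b' -> b = b') ->
    \sum_(a < N) \sum_(b < M a) d a b *: (y ^+ e b * x ^+ f a) = 0 ->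
  forall a b, (a < N)%N -> (b < M a)%N -> d a b = 0.
Proof.
move=> f_inj e_inj Ed a b ltaN ltbM.
pose v : {poly {poly K}} :=
  \sum_(a < N) \sum_(b < M a) (d a b)%:P *: ('X^(e b) *: 'X^(f a)).
have v0 : v = 0.
  by rewrite -[RHS]Ed; apply: eq_bigr => a' _; apply: eq_bigr => b' _; rewrite qmonE.
have : v`_(f a)`_(e b) = 0 by rewrite v0 !coef0.
rewrite /v {v v0} coef_sum (bigD1 (Ordinal ltaN)) //= [X in _ + X]big1 ?addr0; last first.
  move=> a' neq_a; rewrite coef_sum big1 // => b' _; rewrite !coefZ coefXn.
  case: eqP => [/f_inj Ea|]; last by rewrite !mulr0.
  by case/eqP: neq_a; apply: val_inj; rewrite /= Ea.
rewrite !coef_sum (bigD1 (Ordinal ltbM)) //= [X in _ + X]big1 ?addr0; last first.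
  move=> b' neq_b; rewrite !coefZ !coefXn eqxx mulr1 coefCM coefXn.
  case: eqP => [/e_inj Eb|]; last by rewrite !mulr0.
  by case/eqP: neq_b; apply: val_inj; rewrite /= (Eb a).
by rewrite !coefZ coefXn eqxx mulr1 coefCM coefXn eqxx mulr1.
Qed.

(** The monomials are eigenvectors of [rho], so [rho v - k *: v] is a combination
    of the same monomials, with coefficients [d a b] times the difference
    between the eigenvalue of the monomial and [k]. *)
Lemma diag_eigenvector (rho : {lrmorphism A -> A}) mu1 mu2 k
    N (M : nat -> nat) (d : nat -> nat -> K) (e f : nat -> nat) (v : A) :
    diag_on_gens rho mu1 mu2 ->
    (forall a a', (a < N)%N -> (a' < N)%N -> f a = f a' -> a = a') ->
    (forall a b b', (a < N)%N -> (b < M a)%N -> (b' < M a)%N -> e b = e b' -> b = b') ->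
    v = \sum_(a < N) \sum_(b < M a) d a b *: (y ^+ e b * x ^+ f a) ->
  rho v = k *: v <->
  forall a b, (a < N)%N -> (b < M a)%N -> d a b != 0 -> mu1 ^+ f a * mu2 ^+ e b = k.
Proof.
move=> rho_diag f_inj e_inj ->.
have -> : rho (\sum_(a < N) \sum_(b < M a) d a b *: (y ^+ e b * x ^+ f a)) =
    \sum_(a < N) \sum_(b < M a)
       (d a b * (mu1 ^+ f a * mu2 ^+ e b)) *: (y ^+ e b * x ^+ f a).
  rewrite linear_sum; apply: eq_bigr => a _; rewrite linear_sum.
  by apply: eq_bigr => b _; rewrite linearZ /= (diag_monomial _ _ rho_diag) scalerA.
have -> : k *: (\sum_(a < N) \sum_(b < M a) d a b *: (y ^+ e b * x ^+ f a)) =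
    \sum_(a < N) \sum_(b < M a) (d a b * k) *: (y ^+ e b * x ^+ f a).
  rewrite scaler_sumr; apply: eq_bigr => a _; rewrite scaler_sumr.
  by apply: eq_bigr => b _; rewrite scalerA mulrC.
split=> [/eqP | Ek]; last first.
  apply: eq_bigr => a _; apply: eq_bigr => b _; congr (_ *: _).
  by have [->|d0] := eqVneq (d a b) 0; rewrite ?mul0r // Ek.
rewrite -subr_eq0 -sumrB => /eqP Ed a b ltaN ltbM d0.
have : d a b * (mu1 ^+ f a * mu2 ^+ e b) - d a b * k = 0.
  pose D a b := d a b * (mu1 ^+ f a * mu2 ^+ e b) - d a b * k.
  apply: (monomial_sum_free (d := D) f_inj e_inj) => //.
  rewrite -[RHS]Ed; apply: eq_bigr => a' _; rewrite -sumrB.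
  by apply: eq_bigr => b' _; rewrite scalerBl.
move/eqP; rewrite -mulrBr mulf_eq0 (negPf d0) /= subr_eq0.
by move/eqP.
Qed.

(** * Commutation with skew derivations *)

Lemma sderivationZ (sigma : {lrmorphism A -> A}) delta c f :
  is_sderivation sigma delta -> delta (c *: f) = c *: delta f.
Proof.
move=> [delta_lin _]; pose mL := GRing.isLinear.Build K A A *:%R delta delta_lin.
pose D : {linear A -> A} := HB.pack delta mL.
exact: (linearZZ D).
Qed.

(** The defect [rho (delta f) - delta (rho f)] satisfies a twisted Leibniz rule,
    so it vanishes as soon as it vanishes on the two generators. *)
Lemma sderivation_commute (sigma rho : {lrmorphism A -> A}) delta :
    is_sderivation sigma delta -> (forall f, rho (sigma f) = sigma (rho f)) ->
    rho (delta x) = delta (rho x) -> rho (delta y) = delta (rho y) ->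
  forall f, rho (delta f) = delta (rho f).
Proof.
move=> Dd rho_sigma Ex Ey; have [delta_lin deltaM] := Dd.
pose mL := GRing.isLinear.Build K A A *:%R delta delta_lin.
pose D : {linear A -> A} := HB.pack delta mL.
have delta0 : delta 0 = 0 by exact: (raddf0 D).
have deltaD f g : delta (f + g) = delta f + delta g by exact: (raddfD D).
have deltaZ c f : delta (c *: f) = c *: delta f := sderivationZ c f Dd.
have EM f g : rho (delta f) = delta (rho f) -> rho (delta g) = delta (rho g) ->
    rho (delta (f * g)) = delta (rho (f * g)).
  by move=> Ef Eg; rewrite deltaM rmorphD !rmorphM /= deltaM Ef Eg rho_sigma.
have delta1 : delta 1 = 0.
  apply: (addrI (delta 1)); rewrite addr0.
  by rewrite -[in RHS](mulr1 1) deltaM rmorph1 mulr1 mul1r.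
have E1 : rho (delta 1) = delta (rho 1) by rewrite rmorph1 delta1 rmorph0.
have EX f k : rho (delta f) = delta (rho f) -> rho (delta (f ^+ k)) = delta (rho (f ^+ k)).
  by move=> Ef; elim: k => [//|k IHk]; rewrite exprS; apply: EM.
elim/qplane_ind => [|f g Ef Eg|c f Ef|i j].
- by rewrite rmorph0 delta0 rmorph0.
- by rewrite rmorphD !deltaD rmorphD /= Ef Eg.
- by rewrite [rho (c *: f)]linearZ /= !deltaZ linearZ /= Ef.
by apply: EM; apply: EX.
Qed.

Lemma sderivation_commute_gens (sigma rho : {lrmorphism A -> A}) delta mu1 mu2 :
    is_sderivation sigma delta -> (forall f, rho (sigma f) = sigma (rho f)) ->
    diag_on_gens rho mu1 mu2 ->
  (forall f, rho (delta f) = delta (rho f)) <->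
  rho (delta x) = mu1 *: delta x /\ rho (delta y) = mu2 *: delta y.
Proof.
move=> Dd rho_sigma [_ _ rx ry].
split=> [Ed | [Ex Ey]]; first by rewrite !Ed rx ry !(sderivationZ _ _ Dd).
by apply: (sderivation_commute Dd) => //; rewrite ?rx ?ry (sderivationZ _ _ Dd).
Qed.

(** Since every automorphism is diagonal and every pair of nonzero scalars comes
    from one, only the commutation with [delta] remains to be expressed in
    terms of [mu1] and [mu2]. *)
Lemma isotropy_group_criterion (sigma : {lrmorphism A -> A}) alpha beta delta
    (S : K -> K -> Prop) :
    q ^+ 2 != 1 -> sigma x = alpha *: x -> sigma y = beta *: y ->
    (forall (rho : {lrmorphism A -> A}) mu1 mu2,
       bijective rho -> diag_on_gens rho mu1 mu2 ->
       (forall f, rho (sigma f) = sigma (rho f)) ->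
       (forall f, rho (delta f) = delta (rho f)) <-> S mu1 mu2) ->
  isotropy_group_is sigma delta S.
Proof.
move=> q2_neq1 sx sy deltaP; split=> [rho [rho_bij rho_sigma rho_delta]|].
  have [mu1 [mu2 rho_diag]] := qplane_auto_diag q2_neq1 rho_bij.
  by exists mu1, mu2; split=> //; apply/(deltaP rho).
move=> mu1 mu2 mu1_neq0 mu2_neq0 Smu.
have [rho [rho_diag rho_bij]] := diag_auto_exists mu1_neq0 mu2_neq0.
have rho_sigma : forall f, rho (sigma f) = sigma (rho f).
  by case: rho_diag => _ _ rx ry; exact: diag_commute rx ry sx sy.
by exists rho; split=> //; split=> //; apply/(deltaP rho mu1 mu2).
Qed.

(** * The inner family *)

Lemma inner_isotropy (sigma : {lrmorphism A -> A}) alpha beta i j :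
    q ^+ 2 != 1 -> sigma x = alpha *: x -> sigma y = beta *: y ->
    let delta := inner_sder sigma (y ^+ j * x ^+ i) in
    ~ (forall f, delta f = 0) ->
  isotropy_group_is sigma delta (fun mu1 mu2 => mu1 ^+ i * mu2 ^+ j = 1).
Proof.
move=> q2_neq1 sx sy delta delta_neq0.
apply: isotropy_group_criterion q2_neq1 sx sy _ => rho mu1 mu2 rho_bij rho_diag rho_sigma.
have E f : rho (delta f) = (mu1 ^+ i * mu2 ^+ j) *: delta (rho f).
  have := diag_monomial i j rho_diag; rewrite /delta /inner_sder.
  move: (y ^+ j * x ^+ i) => u rho_u; rewrite rmorphB !rmorphM /= rho_sigma rho_u.
  by rewrite scalerBr scalerAl scalerAr.
split=> [Ed | Emu f]; last by rewrite E Emu scale1r.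
apply/eqP; apply/negP => /negP mu_neq1; case: delta_neq0 => f.
have [rho' _ rho'K] := rho_bij.
have /eqP := E (rho' f); rewrite Ed rho'K eq_sym -subr_eq0.
rewrite -[X in _ - X]scale1r -scalerBl scaler_eq0 subr_eq0 (negPf mu_neq1).
by move/eqP.
Qed.

(** * The families supported on one generator *)

Lemma Px_isotropy (sigma : {lrmorphism A -> A}) alpha beta (a : {poly K}) Px :
    q ^+ 2 != 1 -> sigma x = alpha *: x -> sigma y = beta *: y ->
    is_sderivation sigma Px -> Px x = poly_in_y q a -> Px y = 0 ->
  isotropy_group_is sigma Px
    (fun mu1 mu2 => forall r, a`_r != 0 -> mu1 = mu2 ^+ r).
Proof.
move=> q2_neq1 sx sy Pd Pxx Pxy.
apply: isotropy_group_criterion q2_neq1 sx sy _ => rho mu1 mu2 _ rho_diag rho_sigma.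
apply: iff_trans (sderivation_commute_gens Pd rho_sigma rho_diag) _.
have Ev : Px x = \sum_(i < 1) \sum_(r < size a) a`_r *: (y ^+ r * x ^+ 0).
  by rewrite big_ord1 Pxx; apply: eq_bigr => r _; rewrite mulr1.
have := @diag_eigenvector rho mu1 mu2 mu1 1 (fun=> size a) (fun _ r => a`_r)
  id (fun=> 0%N) (Px x) rho_diag _ _ Ev.
case=> // [[|?] [|?] //|Efwd Ebwd]; split=> [[Ex _] r ar0|Emu].
  have ltr : (r < size a)%N by apply: contraNT ar0; rewrite -leqNgt => /(nth_default 0)->.
  by rewrite -(Efwd Ex 0%N r) // mul1r.
split; last by rewrite Pxy rmorph0 scaler0.
by apply: Ebwd => _ r _ _ ar0; rewrite mul1r -Emu.
Qed.

Lemma Py_isotropy (sigma : {lrmorphism A -> A}) alpha beta (b : {poly K}) Py :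
    q ^+ 2 != 1 -> sigma x = alpha *: x -> sigma y = beta *: y ->
    is_sderivation sigma Py -> Py x = 0 -> Py y = poly_in_x q b ->
  isotropy_group_is sigma Py
    (fun mu1 mu2 => forall s, b`_s != 0 -> mu2 = mu1 ^+ s).
Proof.
move=> q2_neq1 sx sy Pd Pyx Pyy.
apply: isotropy_group_criterion q2_neq1 sx sy _ => rho mu1 mu2 _ rho_diag rho_sigma.
apply: iff_trans (sderivation_commute_gens Pd rho_sigma rho_diag) _.
have Ev : Py y = \sum_(s < size b) \sum_(j < 1) b`_s *: (y ^+ 0 * x ^+ s).
  by rewrite Pyy; apply: eq_bigr => s _; rewrite big_ord1 mul1r.
have := @diag_eigenvector rho mu1 mu2 mu2 (size b) (fun=> 1) (fun s _ => b`_s)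
  (fun=> 0%N) id (Py y) rho_diag _ _ Ev.
case=> // [_ [|?] [|?] //|Efwd Ebwd]; split=> [[_ Ey] s bs0|Emu].
  have lts : (s < size b)%N by apply: contraNT bs0; rewrite -leqNgt => /(nth_default 0)->.
  by rewrite -(Efwd Ey s 0%N) // mulr1.
split; first by rewrite Pyx rmorph0 scaler0.
by apply: Ebwd => s _ _ _ bs0; rewrite mulr1 -Emu.
Qed.

(** * Central multiples *)

Section CentralMultiple.
Variable t : nat.
Hypothesis qt1 : q ^+ t = 1.

Lemma comm_qxt f : GRing.comm f (x ^+ t).
Proof.
elim/qplane_ind: f => [|f g Ef Eg|c f Ef|i j].
- exact/commr_sym/commr0.
- exact/commr_sym/commrD/commr_sym/Eg/commr_sym.
- by rewrite /GRing.comm -scalerAl -scalerAr Ef.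
apply/commr_sym/commrM; first apply/commrX.
  by rewrite /GRing.comm -[y]expr1 expr_qx_qy muln1 qt1 scale1r.
exact/commrX/commr_sym/commrX.
Qed.

Lemma comm_qyt f : GRing.comm f (y ^+ t).
Proof.
elim/qplane_ind: f => [|f g Ef Eg|c f Ef|i j].
- exact/commr_sym/commr0.
- exact/commr_sym/commrD/commr_sym/Eg/commr_sym.
- by rewrite /GRing.comm -scalerAl -scalerAr Ef.
apply/commr_sym/commrM; first exact/commrX/commr_sym/commrX.
apply/commrX/commr_sym.
by rewrite /GRing.comm -[x]expr1 expr_qx_qy mul1n qt1 scale1r.
Qed.

Lemma comm_poly_in_xt_yt c f : GRing.comm f (poly_in_xt_yt q t c).
Proof.
apply: commr_sum => a _; apply: commr_sum => b _.
rewrite /GRing.comm -scalerAl -scalerAr; congr (_ *: _).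
by apply: commrM; apply: commrX; [exact: comm_qxt | exact: comm_qyt].
Qed.

Lemma central_sderivation (sigma : {lrmorphism A -> A}) delta (l : A) :
    (forall f, GRing.comm f l) -> is_sderivation sigma delta ->
  is_sderivation sigma (fun f => l * delta f).
Proof.
move=> l_central [delta_lin deltaM]; split=> [c f g|f g].
  by rewrite delta_lin mulrDr scalerAr.
by rewrite deltaM mulrDr !mulrA [f * l]l_central.
Qed.

Lemma poly_in_xt_yt_mul_monomial c n m :
  poly_in_xt_yt q t c * (y ^+ n * x ^+ m) =
  \sum_(a < size c) \sum_(b < size c`_a)
     c`_a`_b *: (y ^+ (n + b * t) * x ^+ (m + a * t)).
Proof.
rewrite mulr_suml; apply: eq_bigr => a _; rewrite mulr_suml; apply: eq_bigr => b _.
rewrite -scalerAl; congr (_ *: _); rewrite -!exprM.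
have xta f : GRing.comm f (x ^+ (t * a)) by rewrite exprM; apply/commrX/comm_qxt.
rewrite -mulrA -xta !mulrA -exprD -mulrA -exprD.
by rewrite [(t * b + n)%N]addnC ![(t * _)%N]mulnC.
Qed.

(** For [t = 0] the exponents do not depend on [a] and [b]; the hypothesis on [c]
    leaves only the constant term, so they are still injective on the range of
    summation.  The scalar [s] accommodates values that become an ordered
    monomial only after commuting [x] and [y]. *)
Lemma central_multiple_eigenvector (rho : {lrmorphism A -> A}) mu1 mu2 k
    (c : {poly {poly K}}) n m (s : K) (v : A) :
    diag_on_gens rho mu1 mu2 -> (t = 0%N -> c = (c`_0`_0)%:P%:P) -> s != 0 ->
    v = s *: (poly_in_xt_yt q t c * (y ^+ n * x ^+ m)) ->
  rho v = k *: v <->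
  forall a b, c`_a`_b != 0 -> mu1 ^+ (m + a * t) * mu2 ^+ (n + b * t) = k.
Proof.
move=> rho_diag c_const s0 Ev.
have c1 : t = 0%N -> (size c <= 1)%N.
  by move=> /c_const->; rewrite size_polyC leq_b1.
have c2 (a : nat) : t = 0%N -> (size (c`_a)%R <= 1)%N.
  by move=> /c_const->; rewrite coefC; case: eqP; rewrite ?size_poly0 ?size_polyC ?leq_b1.
have {}Ev : v = \sum_(a < size c) \sum_(b < size c`_a)
     (s * c`_a`_b) *: (y ^+ (n + b * t) * x ^+ (m + a * t)).
  rewrite Ev poly_in_xt_yt_mul_monomial scaler_sumr; apply: eq_bigr => a _.
  by rewrite scaler_sumr; apply: eq_bigr => b _; rewrite scalerA.
have inj r N a a' : (t = 0%N -> (N <= 1)%N) -> (a < N)%N -> (a' < N)%N ->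
    (r + a * t = r + a' * t)%N -> a = a'.
  case: (posnP t) => [t0 /(_ t0) leN1 /leq_trans/(_ leN1) + /leq_trans/(_ leN1) | ].
    by case: a a' => [|?] [|?].
  by move=> t_gt0 _ _ _ /eqP; rewrite eqn_add2l eqn_pmul2r // => /eqP.
have := @diag_eigenvector rho mu1 mu2 k (size c) (fun a => size c`_a)
  (fun a b => s * c`_a`_b) (fun b => n + b * t)%N (fun a => m + a * t)%N v rho_diag
  _ _ Ev.
case=> [a a'|a b b' _|Efwd Ebwd]; [exact: inj | by apply: inj => /c2 | ].
split=> [/Efwd Ek a b cab|Ek]; last first.
  by apply: Ebwd => a b _ _; rewrite mulf_eq0 negb_or s0 => /Ek.
apply: Ek; last by rewrite mulf_neq0.
  by apply: contraNT cab; rewrite -leqNgt => /(nth_default 0)->; rewrite coef0.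
by apply: contraNT cab; rewrite -leqNgt => /(nth_default 0)->.
Qed.

Lemma central_Dx_isotropy (sigma : {lrmorphism A -> A}) alpha beta n m Dx
    (c : {poly {poly K}}) :
    q ^+ 2 != 1 -> sigma x = alpha *: x -> sigma y = beta *: y ->
    is_sderivation sigma Dx -> Dx x = (y ^+ n * x ^+ m) * x -> Dx y = 0 ->
    (t = 0%N -> c = (c`_0`_0)%:P%:P) ->
  isotropy_group_is sigma (fun f => poly_in_xt_yt q t c * Dx f)
    (fun mu1 mu2 => forall a b, c`_a`_b != 0 ->
       mu1 ^+ (m + a * t) * mu2 ^+ (n + b * t) = 1).
Proof.
move=> q2_neq1 sx sy Dd Dxx Dxy c_const.
apply: isotropy_group_criterion q2_neq1 sx sy _ => rho mu1 mu2 _ rho_diag rho_sigma.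
have Dd' := central_sderivation (comm_poly_in_xt_yt c) Dd.
apply: iff_trans (sderivation_commute_gens Dd' rho_sigma rho_diag) _.
have Ev : poly_in_xt_yt q t c * Dx x =
    1 *: (poly_in_xt_yt q t c * (y ^+ n * x ^+ m.+1)).
  by rewrite scale1r Dxx exprSr !mulrA.
have [Efwd Ebwd] :=
  central_multiple_eigenvector mu1 rho_diag c_const (oner_neq0 K) Ev.
have [mu1_neq0 _ _ _] := rho_diag.
split=> [[/Efwd Ek _] a b /Ek | Ek].
  by rewrite addSn exprS -mulrA -[RHS]mulr1 => /(mulfI mu1_neq0).
split; last by rewrite Dxy mulr0 rmorph0 scaler0.
by apply: Ebwd => a b /Ek Eab; rewrite addSn exprS -mulrA Eab mulr1.
Qed.

Lemma central_Dy_isotropy (sigma : {lrmorphism A -> A}) alpha beta n m Dy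
    (c : {poly {poly K}}) :
    q ^+ 2 != 1 -> sigma x = alpha *: x -> sigma y = beta *: y ->
    is_sderivation sigma Dy -> Dy x = 0 -> Dy y = (y ^+ n * x ^+ m) * y ->
    (t = 0%N -> c = (c`_0`_0)%:P%:P) ->
  isotropy_group_is sigma (fun f => poly_in_xt_yt q t c * Dy f)
    (fun mu1 mu2 => forall a b, c`_a`_b != 0 ->
       mu1 ^+ (m + a * t) * mu2 ^+ (n + b * t) = 1).
Proof.
move=> q2_neq1 sx sy Dd Dyx Dyy c_const.
apply: isotropy_group_criterion q2_neq1 sx sy _ => rho mu1 mu2 _ rho_diag rho_sigma.
have Dd' := central_sderivation (comm_poly_in_xt_yt c) Dd.
apply: iff_trans (sderivation_commute_gens Dd' rho_sigma rho_diag) _.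
(* The scalar comes from moving [y] to the left of [x ^+ m]. *)
have Ev : poly_in_xt_yt q t c * Dy y =
    q ^+ m *: (poly_in_xt_yt q t c * (y ^+ n.+1 * x ^+ m)).
  rewrite Dyy -[_ * y]mulrA -[X in x ^+ m * X]expr1 expr_qx_qy muln1 -!scalerAr.
  by rewrite [y ^+ n.+1]exprSr -[_ * y * x ^+ m]mulrA.
have [Efwd Ebwd] :=
  central_multiple_eigenvector mu2 rho_diag c_const (expf_neq0 m q_neq0) Ev.
have [_ mu2_neq0 _ _] := rho_diag.
split=> [[_ /Efwd Ek] a b /Ek | Ek].
  by rewrite addSn exprSr mulrA -[RHS]mul1r => /(mulIf mu2_neq0).
split; first by rewrite Dyx mulr0 rmorph0 scaler0.
by apply: Ebwd => a b /Ek Eab; rewrite addSn exprSr mulrA Eab mul1r.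
Qed.

End CentralMultiple.
End QuantumPlane.

Theorem proposition5 (K : closedFieldType) (charK : [pchar K] =i pred0)
  (q : K) (q_neq0 : q != 0) (q2_neq1 : q ^+ 2 != 1)
  (alpha beta : K) (alpha_neq0 : alpha != 0) (beta_neq0 : beta != 0)
  (sigma : {lrmorphism qplane q -> qplane q}) (sigma_bij : bijective sigma)
  (sigma_x : sigma (qx q) = alpha *: qx q)
  (sigma_y : sigma (qy q) = beta *: qy q) :
  [/\ (* inner family *)
      forall i j : nat,
        let delta := inner_sder sigma (qy q ^+ j * qx q ^+ i) in
        ~ (forall b, delta b = 0) ->
        isotropy_group_is sigma delta
          (fun mu1 mu2 => mu1 ^+ i * mu2 ^+ j = 1),
      (* P_x family *)
      beta = q ->
      forall (a : {poly K}) (Px : qplane q -> qplane q),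
        is_sderivation sigma Px ->
        Px (qx q) = poly_in_y q a -> Px (qy q) = 0 ->
        isotropy_group_is sigma Px
          (fun mu1 mu2 => forall r : nat, a`_r != 0 -> mu1 = mu2 ^+ r),
      (* P_y family *)
      alpha = q^-1 ->
      forall (b : {poly K}) (Py : qplane q -> qplane q),
        is_sderivation sigma Py ->
        Py (qx q) = 0 -> Py (qy q) = poly_in_x q b ->
        isotropy_group_is sigma Py
          (fun mu1 mu2 => forall s : nat, b`_s != 0 -> mu2 = mu1 ^+ s)
    & (* lambda D_x and lambda D_y families *)
      forall n m t : nat,
        least_nat (fun k => alpha = q ^+ k) n ->
        least_nat (fun k => beta = q ^- k) m ->
        order_or_zero q t ->
      forall Dx Dy : qplane q -> qplane q,
        is_sderivation sigma Dx ->
        Dx (qx q) = (qy q ^+ n * qx q ^+ m) * qx q -> Dx (qy q) = 0 ->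
        is_sderivation sigma Dy ->
        Dy (qx q) = 0 -> Dy (qy q) = (qy q ^+ n * qx q ^+ m) * qy q ->
      forall c : {poly {poly K}},
        (t = 0%N -> c = (c`_0`_0)%:P%:P) ->
        let lambda := poly_in_xt_yt q t c in
        let S mu1 mu2 := forall a b : nat, c`_a`_b != 0 ->
          mu1 ^+ (m + a * t) * mu2 ^+ (n + b * t) = 1 in
        isotropy_group_is sigma (fun f => lambda * Dx f) S /\
        isotropy_group_is sigma (fun f => lambda * Dy f) S].

Proof.
split=> [i j||| n m t _ _ t_order Dx Dy DxD Dxx Dxy DyD Dyx Dyy c c_const lambda S].
- exact: inner_isotropy sigma_x sigma_y.
- by move=> _ a Px PxD Pxx Pxy; exact: Px_isotropy sigma_x sigma_y PxD Pxx Pxy.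
- by move=> _ b Py PyD Pyx Pyy; exact: Py_isotropy sigma_x sigma_y PyD Pyx Pyy.
have qt1 : q ^+ t = 1.
  by case: t_order => [/prim_expr_order // | [-> _]]; rewrite expr0.
split; first exact: central_Dx_isotropy sigma_x sigma_y DxD Dxx Dxy c_const.
exact: central_Dy_isotropy sigma_x sigma_y DyD Dyx Dyy c_const.
Qed.
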